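(* Let $(p_n)_{n\ge 1}$ and $(q_n)_{n\ge 1}$ be real sequences with $0<q_n<p_n\le 1$ for all $n$ and $\lim_{n\to\infty}p_n=1$, $\lim_{n\to\infty}q_n=1$. Let $\omega$ be a modulus of continuity and let $L_n^{p_n,q_n}$ be the $(p,q)$-Bleimann-Butzer-Hahn operators with $p=p_n$, $q=q_n$. Then for every function $f\in H_\omega$, $$st\text{-}\lim_{n}\ \bigl\| L_n^{p_n,q_n}(f;\cdot)-f\bigr\|_{C_B}=0 .$$
   Context: Let $\mathbb{R}_+=[0,\infty)$. For $0<q<p\le 1$ and integers $n\ge 0$, put $[n]_{p,q}=\frac{p^n-q^n}{p-q}$, $[n]_{p,q}!=[1]_{p,q}[2]_{p,q}\cdots[n]_{p,q}$ (with $[0]_{p,q}!=1$), and, for $0\le k\le n$, $\left[\begin{array}{c} n\\ k\end{array}\right]_{p,q}=\frac{[n]_{p,q}!}{[k]_{p,q}!\,[n-k]_{p,q}!}$. The $(p,q)$-Bleimann-Butzer-Hahn operators are defined, for $f:\mathbb{R}_+\to\mathbb{R}$, $x\ge 0$ and $n\ge 1$, by $$L_n^{p,q}(f;x)=\frac{pq}{\ell_n^{p,q}(x)}\sum_{k=0}^n f\left(\frac{p^{n-k+1}[k]_{p,q}}{[n-k+1]_{p,q}\,q^k}\right)p^{\frac{(n-k)(n-k-1)}{2}}q^{\frac{k(k-1)}{2}}\left[\begin{array}{c} n\\ k\end{array}\right]_{p,q}x^k,\qquad \ell_n^{p,q}(x)=\prod_{s=0}^{n-1}(p^s+q^sx).$$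 $C_B(\mathbb{R}_+)$ is the space of bounded continuous real functions on $\mathbb{R}_+$ with norm $\|f\|_{C_B}=\sup_{x\ge 0}|f(x)|$. A modulus of continuity $\omega$ is a function such that: (1) $\omega$ is non-negative and increasing on $\mathbb{R}_+$; (2) $\omega(\delta_1+\delta_2)\le\omega(\delta_1)+\omega(\delta_2)$; (3) $\lim_{\delta\to 0}\omega(\delta)=0$. $H_\omega$ is the space of all real-valued functions $f$ on $\mathbb{R}_+$ with $|f(x)-f(y)|\le\omega\left(\left|\frac{x}{1+x}-\frac{y}{1+y}\right|\right)$ for all $x,y\in\mathbb{R}_+$. The natural density of a set $K$ of positive integers is $\delta(K)=\lim_{n\to\infty}\frac1n\#\{k\le n: k\in K\}$, provided the limit exists. A real sequence $(x_n)$ converges statistically to $l$, written $st\text{-}\lim_n x_n=l$, if for every $\varepsilon>0$ the set $\{k:|x_k-l|\ge\varepsilon\}$ has natural density zero. *)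

(* Defs.v *)
From HB Require Import structures.
From mathcomp Require Import all_boot all_order all_algebra.
From mathcomp Require Import all_classical all_reals all_analysis.
Import Order.TTheory GRing.Theory Num.Theory numFieldNormedType.Exports.

Set Implicit Arguments.
Unset Strict Implicit.
Unset Printing Implicit Defensive.

Local Open Scope classical_set_scope.
Local Open Scope ring_scope.

(* A function on R_+ = [0, +oo[ is represented by a function R -> R; every
   definition below inspects its values on R_+ only. *)

Section PQCalculus.
Context {R : realType}.
Implicit Types (p q x : R) (n k : nat) (f : R -> R).

Definition pq_int p q n : R := (p ^+ n - q ^+ n) / (p - q).

Definition pq_fact p q n : R := \prod_(1 <= i < n.+1) pq_int p q i.

Definition pq_binom p q n k : R :=
  pq_fact p q n / (pq_fact p q k * pq_fact p q (n - k)).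

Definition pq_ell p q n x : R := \prod_(0 <= s < n) (p ^+ s + q ^+ s * x).

Definition pq_node p q n k : R :=
  p ^+ (n - k + 1) * pq_int p q k / (pq_int p q (n - k + 1) * q ^+ k).

(* The (p,q)-Bleimann-Butzer-Hahn operator L_n^{p,q}(f; x).
   The products under ./2 are even, and truncated predecessors only occur
   multiplied by 0, so the exponents are exact. *)
Definition pq_BBH p q n f x : R :=
  p * q / pq_ell p q n x *
  \sum_(0 <= k < n.+1)
     f (pq_node p q n k)
     * p ^+ ((n - k) * (n - k).-1)./2 * q ^+ (k * k.-1)./2
     * pq_binom p q n k * x ^+ k.

End PQCalculus.

Section FunctionSpaces.
Context {R : realType}.
Implicit Types (f g omega : R -> R).

Definition in_CB g : Prop :=
  {within `[0, +oo[%classic, continuous g} /\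
  exists M : R, forall x : R, 0 <= x -> `|g x| <= M.

(* [sup] takes a default value on unbounded sets: this is the norm of C_B only
   for functions g satisfying [in_CB g]. *)
Definition CB_norm g : R := sup [set `|g x| | x in `[0, +oo[%classic].

Definition modulus_of_continuity omega : Prop :=
  [/\ forall d : R, 0 <= d -> 0 <= omega d,
      forall d1 d2 : R, 0 <= d1 -> d1 <= d2 -> omega d1 <= omega d2,
      forall d1 d2 : R, 0 <= d1 -> 0 <= d2 ->
        omega (d1 + d2) <= omega d1 + omega d2
    & omega d @[d --> 0^'+] --> 0].

Definition in_H omega f : Prop :=
  forall x y : R, 0 <= x -> 0 <= y ->
    `|f x - f y| <= omega `|x / (1 + x) - y / (1 + y)|.

End FunctionSpaces.

Section StatisticalConvergence.
Context {R : realType}.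

(* Sets of positive integers are sets of natural numbers whose possible
   element 0 is ignored. *)
Definition has_natural_density (K : set nat) (d : R) : Prop :=
  (\sum_(1 <= k < n.+1 | k \in K) 1)%N%:R / n%:R @[n --> \oo] --> d.

Definition st_lim (u : nat -> R) (l : R) : Prop :=
  forall eps : R, 0 < eps ->
    has_natural_density [set k | eps <= `|u k - l|] 0.

End StatisticalConvergence.

(* Main.v *)
Require Import Defs.
From HB Require Import structures.
From mathcomp Require Import all_boot all_order all_algebra.
From mathcomp Require Import all_classical all_reals all_analysis.
From mathcomp Require Import ring lra zify.
Import Order.TTheory GRing.Theory Num.Theory numFieldNormedType.Exports.

Local Open Scope classical_set_scope.
Local Open Scope ring_scope.

(** The operator is [p * q] times an average.  With the weights
      [W n k x = p^((n-k)(n-k-1)/2) * q^(k(k-1)/2) * binom n k * x^k],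
    the (p,q)-binomial theorem says that the [W n k x] sum to [pq_ell p q n x],
    so [pq_BBH p q n f x] is [p * q] times the mean of the values of [f] at the
    nodes.  The coordinate [t / (1 + t)], in which [omega] measures distances,
    turns the node [t] of index [k] into [p * v k / [n+1]] where
    [v k = p^(n-k) * [k]] (write [m] for the (p,q)-integer of [m]).

    Everything about the weights comes from one device, absorption: multiplying
    [W n.+1 k x] by [v k] or by its complement in [n+1] gives, up to explicit
    factors, a weight of order [n] at the point [q / p * x]
    ([pq_weight_absorb_up], [pq_weight_absorb_down]).  Adding the two identities
    yields the binomial theorem ([sum_pq_weight]); using the first one once and
    twice yields the first two moments of [v] ([pq_mean1], [pq_mean2]).  It
    follows that the node coordinate is concentrated around [x / (1 + x)] with
    mean square deviation at most [2 * p^n / [n+1]] ([pq_mean_variance]), which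
    is at most [2 * ((1 - q) + 1 / (n + 1))] ([pq_rate]), uniformly in [x].

    The coordinate lies between 0 and 1, so monotonicity of [omega] gives the
    Chebyshev-like bound [omega s <= omega d + omega 1 * (s / d)^2]
    ([modulus_le_sqr]).  Averaging it, and paying for the factor [p * q] with
    the bound on [f], gives the uniform estimate [pq_BBH_dist].  Choosing [d]
    first and [n] afterwards, the norms converge to 0 in the usual sense, and
    a convergent sequence converges statistically since only finitely many of
    its terms are far from the limit ([cvg_st_lim]). *)

(** * (p,q)-integers and the weights of the operator *)

Section PQMean.
Context {R : realType} (p q : R) (q_gt0 : 0 < q) (q_lt_p : q < p).
Implicit Types (x : R) (n k : nat) (g h : nat -> R).

Local Notation "[[ n ]]" := (pq_int p q n) (at level 0, n at level 99).

Let p_gt0 : 0 < p. Proof. exact: lt_trans q_lt_p. Qed.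
Let pq_neq0 : p - q != 0. Proof. by rewrite subr_eq0 gt_eqF. Qed.

Lemma pq_int0 : [[0]] = 0.
Proof. by rewrite /pq_int !expr0 subrr mul0r. Qed.

Lemma pq_int1 : [[1]] = 1.
Proof. by rewrite /pq_int !expr1 divff. Qed.

(** The splitting of a (p,q)-integer behind every identity on the weights. *)
Lemma pq_intD m k : [[m + k]] = p ^+ m * [[k]] + q ^+ k * [[m]].
Proof. rewrite /pq_int !exprD; field; exact: pq_neq0. Qed.

Lemma pq_intSl n : [[n.+1]] = p * [[n]] + q ^+ n.
Proof. by rewrite -add1n pq_intD pq_int1 expr1 mulr1. Qed.

Lemma pq_intSr n : [[n.+1]] = p ^+ n + q * [[n]].
Proof. by rewrite -addn1 pq_intD pq_int1 expr1 mulr1. Qed.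

Lemma pq_int_gt0 n : 0 < [[n.+1]].
Proof. by rewrite divr_gt0 ?subr_gt0 // ltrXn2r // ltW. Qed.

Lemma pq_int_ge0 n : 0 <= [[n]].
Proof. by case: n => [|n]; [rewrite pq_int0 | exact/ltW/pq_int_gt0]. Qed.

Lemma pq_factS n : pq_fact p q n.+1 = pq_fact p q n * [[n.+1]].
Proof. by rewrite /pq_fact big_nat_recr. Qed.

Lemma pq_fact_gt0 n : 0 < pq_fact p q n.
Proof.
rewrite /pq_fact big_nat; elim/big_ind: _ => //; first exact: mulr_gt0.
by case=> // i _; exact: pq_int_gt0.
Qed.

Definition pq_weight n k x : R :=
  p ^+ ((n - k) * (n - k).-1)./2 * q ^+ (k * k.-1)./2 * pq_binom p q n k * x ^+ k.

Let half_triangle m : ((m.+1 * m)./2 = (m * m.-1)./2 + m)%N.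
Proof.
case: m => // m; rewrite -[m.+1.-1]/m.
rewrite (_ : (m.+2 * m.+1)%N = (m.+1 * m + m.+1.*2)%N); last by lia.
by rewrite halfD odd_double andbF doubleK.
Qed.

(** The (p,q)-integer cancels in the binomial coefficient.  In both absorption
    identities a factor [p^(n-k) q^k] is set free, partly by the multiplier and
    partly by the drop of a triangular exponent; it equals [p^n (q / p)^k], which
    accounts for the new argument [q / p * x]. *)
Lemma pq_weight_absorb_up n k x : (k <= n)%N ->
  p ^+ (n - k) * [[k.+1]] * pq_weight n.+1 k.+1 x =
  [[n.+1]] * x * (p ^+ n * pq_weight n k (q / p * x)).
Proof.
move=> kn; rewrite /pq_weight /pq_binom subSS !pq_factS !half_triangle.
have k0 := gt_eqF (pq_int_gt0 k); have f0 m := gt_eqF (pq_fact_gt0 m).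
rewrite -[in p ^+ n](subnK kn) 2!exprD exprS !exprMn exprVn.
by field; rewrite ?f0 ?k0 ?gt_eqF // exprn_gt0.
Qed.

Lemma pq_weight_absorb_down n k x : (k <= n)%N ->
  q ^+ k * [[n.+1 - k]] * pq_weight n.+1 k x =
  [[n.+1]] * (p ^+ n * pq_weight n k (q / p * x)).
Proof.
move=> kn; rewrite /pq_weight /pq_binom subSn // !pq_factS !half_triangle.
have k0 := gt_eqF (pq_int_gt0 (n - k)); have f0 m := gt_eqF (pq_fact_gt0 m).
rewrite -[in p ^+ n](subnK kn) 2!exprD !exprMn exprVn.
by field; rewrite ?f0 ?k0 ?gt_eqF // exprn_gt0.
Qed.

(** Summed form of absorption: the term [k = 0] vanishes because [[0]] does, so
    the sum starts at [k = 1] and reindexes to order [n]. *)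
Lemma sum_pq_weight_absorb n g x :
  \sum_(0 <= k < n.+2) p ^+ (n.+1 - k) * [[k]] * g k * pq_weight n.+1 k x =
  [[n.+1]] * x * (p ^+ n * \sum_(0 <= k < n.+1) g k.+1 * pq_weight n k (q / p * x)).
Proof.
rewrite big_nat_recl // pq_int0 mulr0 !mul0r add0r !mulr_sumr.
apply: eq_big_nat => k /andP[_ kn]; rewrite subSS.
by rewrite mulrAC pq_weight_absorb_up //; ring.
Qed.

(** The recursion on the product that absorption produces on the weights: take
    out the first factor instead of the last. *)
Lemma pq_ellS n x : pq_ell p q n.+1 x = (1 + x) * (p ^+ n * pq_ell p q n (q / p * x)).
Proof.
rewrite /pq_ell big_nat_recl // !expr0 mul1r; congr (_ * _).
elim: n => [|n IH]; first by rewrite !big_nil mulr1.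
rewrite !big_nat_recr //= IH !exprS; field.
by rewrite gt_eqF.
Qed.

(** The (p,q)-binomial theorem.  Splitting the constant [[n.+1]] as
    [p^(n+1-k) [k] + q^k [n+1-k]] inside the sum and absorbing both parts, with
    no boundary term since [[0]] vanishes, gives the recursion [pq_ellS]. *)
Lemma sum_pq_weight n x : \sum_(0 <= k < n.+1) pq_weight n k x = pq_ell p q n x.
Proof.
elim: n x => [|n IH] x.
  rewrite big_nat1 /pq_ell big_nil /pq_weight /pq_binom /pq_fact !big_nil.
  by rewrite !(expr0, mulr1, invr1).
rewrite pq_ellS -IH; apply: (mulfI (lt0r_neq0 (pq_int_gt0 n))).
have split_int k : (k < n.+2)%N ->
    [[n.+1]] = p ^+ (n.+1 - k) * [[k]] + q ^+ k * [[n.+1 - k]].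
  by rewrite ltnS => kn; rewrite -pq_intD subnK.
rewrite mulr_sumr big_nat_cond.
under eq_bigr => k /andP[/andP[_ kn] _] do
  rewrite [X in X * _](split_int k kn) mulrDl -[p ^+ _ * _]mulr1.
rewrite -big_nat_cond big_split /= sum_pq_weight_absorb [X in _ + X]big_nat_recr //=.
rewrite subnn pq_int0 mulr0 mul0r addr0.
have -> : \sum_(0 <= k < n.+1) q ^+ k * [[n.+1 - k]] * pq_weight n.+1 k x =
    [[n.+1]] * (p ^+ n * \sum_(0 <= k < n.+1) pq_weight n k (q / p * x)).
  rewrite !mulr_sumr; apply: eq_big_nat => k /andP[_ kn].
  exact: pq_weight_absorb_down.
by under eq_bigr do rewrite mul1r; ring.
Qed.

Lemma pq_ell_gt0 n x : 0 <= x -> 0 < pq_ell p q n x.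
Proof.
move=> x0; rewrite /pq_ell; elim/big_ind: _ => //; first exact: mulr_gt0.
by move=> i _; rewrite ltr_pwDl ?exprn_gt0 // mulr_ge0 // exprn_ge0 // ltW.
Qed.

Lemma pq_weight_ge0 n k x : 0 <= x -> 0 <= pq_weight n k x.
Proof.
move=> x0; rewrite /pq_weight /pq_binom.
have [p0 q0] := (ltW p_gt0, ltW q_gt0).
by rewrite !mulr_ge0 ?exprn_ge0 // ?invr_ge0 ?mulr_ge0 // ltW // pq_fact_gt0.
Qed.

(** * Means and variance of the nodes *)

Let shift_ge0 x : 0 <= x -> 0 <= q / p * x.
Proof. by move=> x0; rewrite mulr_ge0 // divr_ge0 // ltW. Qed.

Definition pq_mean n x g : R :=
  (\sum_(0 <= k < n.+1) g k * pq_weight n k x) / pq_ell p q n x.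

Lemma eq_pq_mean n x g h : (forall k, (k <= n)%N -> g k = h k) ->
  pq_mean n x g = pq_mean n x h.
Proof.
move=> gh; rewrite /pq_mean; congr (_ / _).
by apply: eq_big_nat => k /andP[_ kn]; rewrite gh.
Qed.

Lemma ler_pq_mean n x g h : 0 <= x -> (forall k, (k <= n)%N -> g k <= h k) ->
  pq_mean n x g <= pq_mean n x h.
Proof.
move=> x0 gh; rewrite /pq_mean ler_pM2r ?invr_gt0 ?pq_ell_gt0 //.
rewrite big_nat [leRHS]big_nat; apply: ler_sum => k /andP[_ kn].
by rewrite ler_wpM2r ?pq_weight_ge0 // gh.
Qed.

Lemma pq_meanD n x g h :
  pq_mean n x (fun k => g k + h k) = pq_mean n x g + pq_mean n x h.
Proof.
rewrite /pq_mean -mulrDl -big_split /=; congr (_ / _).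
by apply: eq_bigr => k _; rewrite mulrDl.
Qed.

Lemma pq_meanZ n x a g :
  pq_mean n x (fun k => a * g k) = a * pq_mean n x g.
Proof.
rewrite /pq_mean mulrA mulr_sumr; congr (_ / _).
by apply: eq_bigr => k _; rewrite mulrA.
Qed.

Lemma pq_mean_cst n x a : 0 <= x -> pq_mean n x (fun=> a) = a.
Proof.
move=> x0; rewrite /pq_mean -mulr_sumr sum_pq_weight mulfK //.
exact/lt0r_neq0/pq_ell_gt0.
Qed.

Lemma ler_norm_pq_mean n x g : 0 <= x ->
  `|pq_mean n x g| <= pq_mean n x (fun k => `|g k|).
Proof.
move=> x0; rewrite ler_norml -mulN1r -pq_meanZ.
apply/andP; split; apply: ler_pq_mean => // k _; rewrite ?ler_norm //.
by rewrite mulN1r lerNl ler_normr lexx orbT.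
Qed.

(** Weighting by [p^(n-k) [k]] is, up to its mean, passing to the distribution of
    order one less at [q / p * x], shifted by one index. *)
Lemma pq_mean_absorb n x g : 0 <= x ->
  pq_mean n.+1 x (fun k => p ^+ (n.+1 - k) * [[k]] * g k) =
  [[n.+1]] * (x / (1 + x)) * pq_mean n (q / p * x) (fun k => g k.+1).
Proof.
move=> x0; rewrite /pq_mean sum_pq_weight_absorb pq_ellS.
have y0 := shift_ge0 x x0.
field; rewrite !gt_eqF ?pq_ell_gt0 ?exprn_gt0 //; lra.
Qed.

Lemma pq_mean1 n x : 0 <= x ->
  pq_mean n x (fun k => p ^+ (n - k) * [[k]]) = [[n]] * (x / (1 + x)).
Proof.
case: n => [|n] x0.
  rewrite (eq_pq_mean _ _ _ (fun=> 0)) ?pq_mean_cst ?pq_int0 ?mul0r //.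
  by move=> k; rewrite leqn0 => /eqP ->; rewrite pq_int0 mulr0.
rewrite (eq_pq_mean _ _ _ (fun k => p ^+ (n.+1 - k) * [[k]] * 1)); last first.
  by move=> k _; rewrite mulr1.
by rewrite pq_mean_absorb // pq_mean_cst ?mulr1 ?shift_ge0.
Qed.

(** Absorb twice: after the first time the integrand is [p^(n-k) [k+1]], and
    [[k+1] = p^k + q [k]] reduces it to the first moment at [q / p * x]. *)
Lemma pq_mean2 n x : 0 <= x ->
  pq_mean n.+1 x (fun k => (p ^+ (n.+1 - k) * [[k]]) ^+ 2) =
  [[n.+1]] * (x / (1 + x)) * (p ^+ n + q * ([[n]] * (q * x / (p + q * x)))).
Proof.
move=> x0; have y0 := shift_ge0 x x0.
under [X in pq_mean _ _ X]funext => k do rewrite expr2.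
rewrite pq_mean_absorb //; congr (_ * _).
rewrite (eq_pq_mean _ _ _ (fun k => p ^+ n + q * (p ^+ (n - k) * [[k]]))); last first.
  by move=> k kn; rewrite subSS pq_intSr mulrDr -exprD subnK //; ring.
rewrite pq_meanD pq_meanZ pq_mean_cst // pq_mean1 //; congr (_ + _ * (_ * _)).
by field; rewrite !gt_eqF // ltr_wpDr // mulr_ge0 // ltW.
Qed.

(** With [X = x / (1 + x)], [s = p [n+1] / [n+2]] and [c = p^(n+1) / [n+2]], the
    scaled variable has mean [s X], and second moment at most
    [s X (c + (s - c) X)] because [q x / (p + q x) <= X].  The mean square
    deviation from [X] is then at most [s c X (1 - X) + (1 - s)^2 X^2], and
    [1 - s = q^(n+1) / [n+2]] is at most [c]. *)
Lemma pq_mean_variance n x : 0 <= x ->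
  pq_mean n.+1 x
    (fun k => (p * (p ^+ (n.+1 - k) * [[k]]) / [[n.+2]] - x / (1 + x)) ^+ 2)
  <= 2 * (p ^+ n.+1 / [[n.+2]]).
Proof.
move=> x0; set X := x / (1 + x); set D := [[n.+2]].
have D0 : 0 < D by exact: pq_int_gt0.
(* The square is expanded so that only the moments of [p^(n+1-k) [k]] occur. *)
rewrite (eq_pq_mean _ _ _ (fun k =>
    (p / D) ^+ 2 * (p ^+ (n.+1 - k) * [[k]]) ^+ 2 +
    (- (2 * X * (p / D)) * (p ^+ (n.+1 - k) * [[k]]) + X ^+ 2))); last first.
  by move=> k _; field; rewrite gt_eqF.
rewrite !(pq_meanD, pq_meanZ) pq_mean_cst // pq_mean1 // pq_mean2 //.
rewrite -/X; set Y := q * x / (p + q * x).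
have qx0 : 0 <= q * x by rewrite mulr_ge0 // ltW.
have X01 : 0 <= X <= 1.
  by rewrite divr_ge0 ?addr_ge0 //= ler_pdivrMr ?mul1r ?lerDr ?ltr_wpDr.
have YX : Y <= X.
  rewrite ler_pdivrMr ?ltr_wpDr // mulrAC ler_pdivlMr ?ltr_wpDr //.
  have := ler_wpM2r x0 (ltW q_lt_p); nra.
have A0 : 0 <= [[n.+1]] by exact: pq_int_ge0.
have B0 : 0 <= [[n]] by exact: pq_int_ge0.
have qpn : q ^+ n.+1 <= p ^+ n.+1 by rewrite lerXn2r ?nnegrE ?ltW.
have AE : [[n.+1]] = p ^+ n + q * [[n]] by exact: pq_intSr.
have DE : D = p * [[n.+1]] + q ^+ n.+1 by exact: pq_intSl.
have qn0 : 0 <= q ^+ n.+1 by rewrite exprn_ge0 // ltW.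
pose s := p * [[n.+1]] / D; pose c := p ^+ n.+1 / D.
have s0 : 0 <= s by exact: divr_ge0 (mulr_ge0 (ltW p_gt0) A0) (ltW D0).
have s1 : s <= 1 by rewrite ler_pdivrMr // mul1r DE lerDl.
have sc : 1 - s <= c.
  rewrite -[1](divff (lt0r_neq0 D0)) -mulrBl ler_wpM2r ?invr_ge0 ?(ltW D0) //.
  by rewrite DE addrC addKr.
have second_moment : (p / D) ^+ 2 * ([[n.+1]] * X * (p ^+ n + q * ([[n]] * Y))) <=
    s * X * (c + (s - c) * X).
  have -> : s * X * (c + (s - c) * X) =
      (p / D) ^+ 2 * ([[n.+1]] * X * (p ^+ n + q * ([[n]] * X))).
    by rewrite /s /c AE exprS; field; rewrite gt_eqF.
  have [X0 _] := andP X01; apply: ler_wpM2l; first exact: sqr_ge0.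
  apply: ler_wpM2l; first exact: mulr_ge0.
  rewrite lerD2l; apply: ler_wpM2l; first exact: ltW.
  by rewrite ler_wpM2l.
have -> : - (2 * X * (p / D)) * ([[n.+1]] * X) = - (2 * s * X ^+ 2).
  by rewrite /s; field; rewrite gt_eqF.
rewrite -/c; clearbody s c; clear -second_moment X01 s0 s1 sc.
have [X0 X1] := andP X01.
have c0 : 0 <= c by lra.
have : s * c * (X * (1 - X)) + (1 - s) ^+ 2 * X ^+ 2 <= c + (1 - s).
  apply: lerD.
    rewrite mulrAC -[leRHS]mul1r ler_wpM2r // mulr_ile1 //; nra.
  rewrite expr2 -mulrA -[leRHS]mulr1 ler_wpM2l ?subr_ge0 //; nra.
move: second_moment; set m2 := _ ^+ 2 * _; nra.
Qed.

(** [[n]] is a sum of [n] terms, each at least [q^(n-1)]; the factor [q] avoids the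
    predecessor. *)
Lemma pq_int_ge n : n%:R * q ^+ n <= q * [[n]].
Proof.
elim: n => [|n IH]; first by rewrite mul0r pq_int0 mulr0.
rewrite pq_intSl exprS -natr1.
have h1 := ler_wpM2l (ltW p_gt0) IH.
have h2 : q * (n%:R * q ^+ n) <= p * (n%:R * q ^+ n).
  by rewrite ler_wpM2r ?mulr_ge0 ?exprn_ge0 // ltW.
move: h1 h2; move: (n%:R) (q ^+ n) [[n]] => a b c; nra.
Qed.

(** Since [(p - q) [n+1] = p^(n+1) - q^(n+1)], the quotient differs from
    [1 - q / p <= 1 - q] by [q^(n+1) / (p [n+1])], which is small because [[n+1]]
    has [n + 1] summands. *)
Lemma pq_rate n : p <= 1 -> p ^+ n / [[n.+1]] <= (1 - q) + n.+1%:R^-1.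
Proof.
move=> p1; have D0 : 0 < [[n.+1]] by exact: pq_int_gt0.
rewrite ler_pdivrMr // -(ler_pM2l p_gt0) -exprS.
have h1 : p ^+ n.+1 - q ^+ n.+1 = [[n.+1]] * (p - q).
  by rewrite /pq_int divfK // subr_eq0 gt_eqF.
have h2 : q ^+ n.+1 <= q * [[n.+1]] / n.+1%:R.
  by rewrite ler_pdivlMr ?ltr0n // mulrC pq_int_ge.
have h3 : q * [[n.+1]] / n.+1%:R <= p * [[n.+1]] / n.+1%:R.
  by rewrite ler_wpM2r ?invr_ge0 ?ler0n // ler_wpM2r // ltW.
have h4 : [[n.+1]] * (p - q) <= [[n.+1]] * (p * (1 - q)).
  rewrite ler_wpM2l ?(ltW D0) //; have := ler_wpM2r (ltW q_gt0) p1; lra.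
rewrite mulrDl mulrDr [X in _ <= _ + X](_ : _ = p * [[n.+1]] / n.+1%:R); last by ring.
have h23 := le_trans h2 h3; move: h1 h4 h23.
move: (p ^+ _) (q ^+ _) [[n.+1]] (p * _ / _) => a b c d; nra.
Qed.

Lemma pq_node_ge0 n k : 0 <= pq_node p q n k.
Proof.
by rewrite divr_ge0 // mulr_ge0 ?exprn_ge0 ?pq_int_ge0 // ltW.
Qed.

(** The identity [[n+1] = p^(n-k+1) [k] + q^k [n-k+1]] makes the denominator of the
    node coordinate independent of [k]. *)
Lemma pq_node_frac n k : (k <= n)%N ->
  pq_node p q n k / (1 + pq_node p q n k) = p * (p ^+ (n - k) * [[k]]) / [[n.+1]].
Proof.
move=> kn; rewrite -[in RHS](subnK kn) -addSn pq_intD // /pq_node addn1.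
have h : 0 < [[(n - k).+1]] * q ^+ k by rewrite mulr_gt0 ?pq_int_gt0 ?exprn_gt0.
have h' : 0 <= p ^+ (n - k).+1 * [[k]].
  by rewrite mulr_ge0 ?pq_int_ge0 ?exprn_ge0 // ltW.
rewrite addnK [p * (_ * _)]mulrA -exprS.
move: [[(n - k).+1]] [[k]] (q ^+ k) (p ^+ _) h h' => a b c d h h'.
have [a0 c0] : a != 0 /\ c != 0 by apply/andP; rewrite -negb_or -mulf_eq0 gt_eqF.
by field; rewrite a0 c0 gt_eqF //; lra.
Qed.

Lemma pq_BBH_mean n f x :
  pq_BBH p q n f x = p * q * pq_mean n x (fun k => f (pq_node p q n k)).
Proof.
rewrite /pq_BBH /pq_mean mulrAC -mulrA; congr (_ * (_ / _)).
by apply: eq_bigr => k _; rewrite /pq_weight !mulrA.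
Qed.

End PQMean.

(** * Functions controlled by a modulus of continuity *)

Section ModulusSpace.
Context {R : realType} (omega f : R -> R).
Context (omegaP : modulus_of_continuity omega) (fH : in_H omega f).
Implicit Types (x y d s : R).

Lemma frac_itv01 x : 0 <= x -> 0 <= x / (1 + x) <= 1.
Proof.
move=> x0; have x1 : 0 < 1 + x by lra.
by rewrite divr_ge0 ?(ltW x1) // ler_pdivrMr // mul1r; lra.
Qed.

Lemma frac_dist_le1 x y : 0 <= x -> 0 <= y ->
  `|x / (1 + x) - y / (1 + y)| <= 1.
Proof.
move=> /frac_itv01 /andP[? ?] /frac_itv01 /andP[? ?].
rewrite ler_norml; lra.
Qed.

(** The map [x / (1 + x)] is a contraction of the half-line: its difference quotient
    is [1 / ((1 + x) (1 + y))]. *)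
Lemma frac_dist_le x y : 0 <= x -> 0 <= y ->
  `|x / (1 + x) - y / (1 + y)| <= `|x - y|.
Proof.
move=> x0 y0; have x1 : 0 < 1 + x by lra.
have y1 : 0 < 1 + y by lra.
have -> : x / (1 + x) - y / (1 + y) = (x - y) / ((1 + x) * (1 + y)).
  by field; rewrite !gt_eqF.
have h : 1 <= (1 + x) * (1 + y) by nra.
rewrite normrM normfV [`|_ * (1 + y)|]ger0_norm; last by lra.
by rewrite ler_pdivrMr ?ler_peMr //; lra.
Qed.

(** Trades the modulus for a square, so that averages of [omega] are controlled by a
    variance: if [s > d] then [(s / d)^2 >= 1] and [omega s <= omega 1]. *)
Lemma modulus_le_sqr d s : 0 < d -> 0 <= s -> s <= 1 ->
  omega s <= omega d + omega 1 * (s / d) ^+ 2.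
Proof.
case: omegaP => omega0 omega_incr _ _ d0 s0 s1.
have [sd|ds] := leP s d.
  apply: ler_wpDr; last exact: omega_incr.
  by rewrite mulr_ge0 ?sqr_ge0 ?omega0.
apply: ler_wpDl; first by rewrite omega0 // ltW.
apply: (le_trans (omega_incr _ _ s0 s1)); apply: ler_peMr; first exact: omega0.
by rewrite expr_ge1 ?divr_ge0 ?(ltW d0) // ler_pdivlMr // mul1r ltW.
Qed.

Lemma in_H_bounded x : 0 <= x -> `|f x| <= `|f 0| + omega 1.
Proof.
case: omegaP => omega0 omega_incr _ _ x0.
have := ler_normD (f x - f 0) (f 0); rewrite subrK.
have := omega_incr _ _ (normr_ge0 _) (frac_dist_le1 x 0 x0 (lexx 0)).
by have := fH x 0 x0 (lexx 0); lra.
Qed.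

Lemma in_H_continuous : {within `[0, +oo[%classic, continuous f}.
Proof.
case: (omegaP) => omega0 omega_incr _ omega_cvg.
apply/subspace_continuousP => x /=; rewrite in_itv /= andbT => x0.
apply/cvgrPdist_lt => e e0.
have /filter_ex[d [d0 od]] : \forall d \near 0^'+, 0 < d /\ `|omega d| < e.
  by near=> d; split; near: d; [exact: nbhs_right_gt | exact: cvgr0_norm_lt].
rewrite near_withinE; near=> y => /=; rewrite in_itv /= andbT => y0.
rewrite (le_lt_trans (fH x y x0 y0)) // (le_lt_trans _ od) //.
rewrite (le_trans _ (ler_norm _)) // omega_incr //.
by rewrite (le_trans (frac_dist_le x y x0 y0)) // ltW.
Unshelve. all: by end_near. Qed.

End ModulusSpace.

(** * The uniform estimate for the operator *)

Section PQOperator.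
Context {R : realType} (p q : R) (q_gt0 : 0 < q) (q_lt_p : q < p) (p_le1 : p <= 1).
Implicit Types (x d : R) (n : nat).

Let p_gt0 : 0 < p. Proof. exact: lt_trans q_lt_p. Qed.

(** The operator sends the constant 1 to [p * q], whence the last term; the two others
    average [modulus_le_sqr] over the nodes.  The bound does not depend on [x]. *)
Lemma pq_BBH_dist omega f n d x :
    modulus_of_continuity omega -> in_H omega f -> 0 < d -> 0 <= x ->
  `|pq_BBH p q n.+1 f x - f x| <=
    omega d + 2 * omega 1 / d ^+ 2 * ((1 - q) + n.+2%:R^-1)
    + (1 - p * q) * (`|f 0| + omega 1).
Proof.
move=> omegaP fH d0 x0; case: (omegaP) => omega0 _ _ _.
have pq01 : 0 <= p * q <= 1.
  have q1 := le_trans (ltW q_lt_p) p_le1.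
  by rewrite mulr_ge0 ?mulr_ile1 // ltW.
have [pq0 pq1] := andP pq01.
have M0 : 0 <= omega 1 / d ^+ 2 by rewrite divr_ge0 ?omega0 ?sqr_ge0.
rewrite pq_BBH_mean; set m := pq_mean _ _ _ _ _.
have mE : m - f x = pq_mean p q n.+1 x (fun k => f (pq_node p q n.+1 k) - f x).
  by rewrite pq_meanD pq_mean_cst.
have dist_mean : `|m - f x| <=
    omega d + omega 1 / d ^+ 2 * (2 * (p ^+ n.+1 / pq_int p q n.+2)).
  rewrite mE (le_trans (ler_norm_pq_mean _ _ _ _ _ _ _ _)) //.
  have var := pq_mean_variance p q q_gt0 q_lt_p n x x0.
  apply: le_trans (lerD (lexx (omega d)) (ler_wpM2l M0 var)).
  rewrite -[omega d in leRHS](pq_mean_cst p q q_gt0 q_lt_p n.+1 x) //.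
  rewrite -pq_meanZ -pq_meanD.
  apply: ler_pq_mean => // k kn; rewrite -pq_node_frac //.
  set t := pq_node _ _ _ _; have t0 : 0 <= t by exact: pq_node_ge0.
  apply: le_trans (fH _ _ t0 x0) _.
  have dist1 := frac_dist_le1 _ _ t0 x0.
  apply: le_trans (modulus_le_sqr _ omegaP d _ d0 (normr_ge0 _) dist1) _.
  by rewrite expr_div_n real_normK ?num_real // mulrA [in leRHS]mulrAC.
have -> : p * q * m - f x = p * q * (m - f x) + - ((1 - p * q) * f x) by ring.
apply: le_trans (ler_normD _ _) _.
rewrite normrN [`|_ * f x|]normrM [`|_ * (m - _)|]normrM.
have pq1_ge0 : 0 <= 1 - p * q by rewrite subr_ge0.
rewrite (ger0_norm pq0) (ger0_norm pq1_ge0); apply: lerD; last first.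
  exact: ler_wpM2l pq1_ge0 _ _ (in_H_bounded _ _ omegaP fH x x0).
apply: le_trans (ler_piMl (normr_ge0 _) pq1) _; apply: le_trans dist_mean _.
have -> : 2 * omega 1 / d ^+ 2 * (1 - q + n.+2%:R^-1) =
    omega 1 / d ^+ 2 * (2 * (1 - q + n.+2%:R^-1)) by ring.
by rewrite lerD2l ler_wpM2l // ler_pM2l // pq_rate.
Qed.

Lemma pq_ell_continuous n : continuous (pq_ell p q n : R -> R).
Proof.
apply: continuous_big => [|s _ x]; first exact: mul_continuous.
by apply: cvgD; [exact: cvg_cst | apply: cvgMr; exact: cvg_id].
Qed.

Lemma pq_BBH_continuous n f :
  {within `[0, +oo[%classic, continuous (pq_BBH p q n f)}.
Proof.
apply: continuous_in_subspaceT => x; rewrite inE /= in_itv /= andbT => x0.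
have ell0 : pq_ell p q n x != 0 by exact/lt0r_neq0/pq_ell_gt0.
rewrite /pq_BBH; apply: cvgM.
  apply: cvgM; first exact: cvg_cst.
  by apply: cvgV => //; exact: pq_ell_continuous.
apply: (continuous_big add_continuous) => k _ y.
by apply: cvgMr; exact: exprn_continuous.
Qed.

End PQOperator.

(** * Statistical convergence and the norm *)

(** The exceptional set is contained in some [0, N[, so its density is at most the
    limit of [N / n]. *)
Lemma cvg_st_lim {R : realType} (u : nat -> R) (l : R) :
  u n @[n --> \oo] --> l -> st_lim u l.
Proof.
move=> /cvgrPdist_lt ul eps eps0; have [N _ ulN] := ul _ eps0.
apply/cvgrPdist_lt => e e0; near=> n.
have n0 : 0 < n%:R :> R by rewrite ltr0n; near: n; exact: nbhs_infty_gt.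
rewrite sub0r normrN ger0_norm ?divr_ge0 ?ler0n // ltr_pdivrMr // mulrC.
apply: (@le_lt_trans _ _ N%:R); last first.
  by rewrite -ltr_pdivrMr //; near: n; exact: nbhs_infty_gtr.
rewrite ler_nat sum1_count -size_filter -[leqRHS](size_iota 0).
apply: uniq_leq_size => [|k]; first by rewrite filter_uniq ?iota_uniq.
rewrite mem_filter mem_iota add0n /= => /andP[/set_mem /= far _].
rewrite ltnNge; apply/negP => Nk.
by have := ulN k Nk; rewrite /= distrC ltNge far.
Unshelve. all: by end_near. Qed.

Lemma CB_norm_ge0 {R : realType} (g : R -> R) M :
  (forall x, 0 <= x -> `|g x| <= M) -> 0 <= CB_norm g.
Proof.
move=> gM; apply: le_trans (normr_ge0 (g 0)) _; apply: ub_le_sup.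
  by exists M => _ [x + <-]; rewrite /= in_itv /= andbT; exact: gM.
by exists 0 => //=; rewrite in_itv /= lexx.
Qed.

Lemma CB_norm_le {R : realType} (g : R -> R) M :
  (forall x, 0 <= x -> `|g x| <= M) -> CB_norm g <= M.
Proof.
move=> gM; apply: ge_sup.
  by exists `|g 0|, 0 => //=; rewrite in_itv /= lexx.
by move=> _ [x + <-]; rewrite /= in_itv /= andbT; exact: gM.
Qed.

Theorem theorem2p2 (R : realType) (p q : nat -> R) (omega : R -> R)
    (hpq : forall n : nat, (0 < n)%N -> [/\ 0 < q n, q n < p n & p n <= 1])
    (hp : p n @[n --> \oo] --> (1 : R))
    (hq : q n @[n --> \oo] --> (1 : R))
    (homega : modulus_of_continuity omega)
    (f : R -> R) (hf : in_H omega f) :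
  (forall n : nat, (0 < n)%N ->
     in_CB (fun x => pq_BBH (p n) (q n) n f x - f x)) /\
  st_lim (fun n : nat =>
     CB_norm (fun x => pq_BBH (p n) (q n) n f x - f x)) 0.
Proof.
(* For fixed [d] only the part of the bound next to [omega d] depends on [n], and it
   tends to 0; hence [d] is chosen before [n]. *)
pose err d n := omega d + (2 * omega 1 / d ^+ 2 * ((1 - q n) + n.+1%:R^-1)
    + (1 - p n * q n) * (`|f 0| + omega 1)).
have dist_err d n x : 0 < d -> (0 < n)%N -> 0 <= x ->
    `|pq_BBH (p n) (q n) n f x - f x| <= err d n.
  by case: n => // n d0 /hpq[q0 qp p1] x0; rewrite /err addrA; exact: pq_BBH_dist.
split=> [n n0|].
  have [q0 qp p1] := hpq n n0; split; last by exists (err 1 n) => x; exact: dist_err.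
  move=> x; apply: cvgB; first exact: pq_BBH_continuous.
  exact: in_H_continuous homega hf x.
apply: cvg_st_lim; apply/cvgr0Pnorm_lt => e e0.
case: (homega) => _ _ _ omega_cvg.
have e20 : 0 < e / 2 by rewrite divr_gt0.
have /filter_ex[d [d0 od]] : \forall d \near 0^'+, 0 < d /\ `|omega d| < e / 2.
  by near=> d; split; near: d; [exact: nbhs_right_gt | exact: cvgr0_norm_lt].
have err_cvg : err d n - omega d @[n --> \oo] --> 0.
  under eq_fun do rewrite /err addrC addKr.
  suff : 2 * omega 1 / d ^+ 2 * ((1 - q n) + n.+1%:R^-1)
      + (1 - p n * q n) * (`|f 0| + omega 1) @[n --> \oo] -->
      2 * omega 1 / d ^+ 2 * ((1 - 1) + 0) + (1 - 1 * 1) * (`|f 0| + omega 1).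
    by rewrite mulr1 subrr addr0 mulr0 mul0r addr0.
  apply: cvgD.
    apply: cvgMr; apply: cvgD; last exact: cvg_harmonic.
    by apply: cvgB => //; exact: cvg_cst.
  by apply: cvgMl; apply: cvgB; [exact: cvg_cst | exact: cvgM].
near=> n.
have n0 : (0 < n)%N by near: n; exact: nbhs_infty_gt.
have dist_n x := dist_err d n x d0 n0.
rewrite ger0_norm; last exact: CB_norm_ge0 dist_n.
apply: le_lt_trans (CB_norm_le _ _ dist_n) _.
have : `|err d n - omega d| < e / 2 by near: n; exact: cvgr0_norm_lt.
have := ler_norm (err d n - omega d); have := ler_norm (omega d); lra.
Unshelve. all: by end_near. Qed.
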